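(* For every integer $k\ge 1$ the following hold. (a) $$\mathcal M_k=\left(\bigoplus_{s=0}^m H^s_k\right)\oplus\left(\bigoplus_{s=1}^{m-1}M_{s,k}\right),\qquad\text{where}\quad M_{s,k}=\big[(k-1+m-s)\,x^*-(k-1+s)\,x\big]H^s_{k-1}.$$ (b) $$(x+x^* )\mathcal M_{k-1}=\left(\bigoplus_{s=0}^m(x+x^* )H^s_{k-1}\right)\oplus\left(\bigoplus_{s=1}^{m-1}W^s_k\right),$$ where $W^s_k=\big[(k-2+m-s)\,xx^*-(k-2+s)\,x^*x\big]H^s_{k-2}$ for $k\ge 2$, and $W^s_1=\{0\}$.
   Context: Let $m$ be a positive integer and let $\mathcal P$ be the space of complex-valued polynomials on $\mathbb R^m$ in the variables $x_1,\dots,x_m$, with $\mathcal P_k$ the subspace of $k$-homogeneous polynomials. Let $\Lambda^*(\mathbb C^m)=\bigoplus_{s=0}^m\Lambda^s(\mathbb C^m)$ be the Grassmann algebra with generators $dx_1,\dots,dx_m$, and put $\mathcal P^*=\mathcal P\otimes\Lambda^*(\mathbb C^m)$, $\mathcal P^*_k=\mathcal P_k\otimes\Lambda^*(\mathbb C^m)$, $\mathcal P^s_k=\mathcal P_k\otimes\Lambda^s(\mathbb C^m)$. Elements of $\mathcal P^s_k$ are written $P=\sum_I P_I\,dx_I$, the sum running over strictly increasing sequences $I=(i_1<\dots<i_s)$ in $\{1,\dots,m\}$, with $P_I\in\mathcal P_k$ and $dx_I=dx_{i_1}\wedge\cdots\wedge dx_{i_s}$. The contraction $dx_j\rfloor$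 is defined by $dx_j\rfloor\, dx_I=\sum_{l=1}^s(-1)^{l-1}\delta_{j i_l}\,dx_{I\setminus\{i_l\}}$ and $dx_j\rfloor P=\sum_I P_I\,(dx_j\rfloor\, dx_I)$. Define linear operators on $\mathcal P^*$ by $$d=\sum_{j=1}^m\partial_{x_j}\,dx_j\wedge,\qquad d^*=-\sum_{j=1}^m\partial_{x_j}\,dx_j\rfloor,\qquad x=-\sum_{j=1}^m x_j\,dx_j\wedge,\qquad x^*=\sum_{j=1}^m x_j\,dx_j\rfloor .$$ For $0\le s\le m$ and $k\ge 0$ put $$H^s_k=\{P\in\mathcal P^s_k:\ dP=0,\ d^*P=0\},\qquad \mathcal M_k=\{P\in\mathcal P^*_k:\ (d+d^* )P=0\}.$$ For a linear operator $T$ and a subspace $H$, $TH$ denotes the image of $H$ under $T$; products such as $xx^*$ denote compositions of operators. *)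

(* Defs.v *)
From mathcomp Require Import all_boot all_order all_algebra.
From mathcomp Require Import complex mpoly.
From mathcomp Require Import reals.
Set Implicit Arguments.
Unset Strict Implicit.
Unset Printing Implicit Defensive.
Import GRing.Theory.
Local Open Scope ring_scope.

(* The space P^* = P (x) Lambda^*(C^m), with C = R[i].  The strictly increasing
   sequences I in {1, ..., m} are represented by the subsets of 'I_m (the
   variables are numbered from 0), and a form P = sum_I P_I dx_I by its family
   of coefficients I |-> P_I.  Over the infinite field C, polynomials and
   polynomial functions on R^m are the same thing. *)
Notation polyform R m := {ffun {set 'I_m} -> {mpoly R[i][m]}}.

Definition monoform {R : realType} {m : nat}
    (p : {mpoly R[i][m]}) (I : {set 'I_m}) : polyform R m :=
  [ffun J => if J == I then p else 0].

(* Number of elements of I smaller than j.  If I = (i_1 < ... < i_s), then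
   nbelow i_l I = l - 1. *)
Definition nbelow {m : nat} (j : 'I_m) (I : {set 'I_m}) : nat :=
  #|[set i in I | (i < j)%N]|.

(* Left multiplication by dx_j in the Grassmann algebra: dx_j /\ dx_I is 0 if j
   belongs to I; otherwise reordering the factors of dx_j /\ dx_I increasingly
   costs nbelow j I transpositions. *)
Definition dx_wedge {R : realType} {m : nat} (j : 'I_m) (P : polyform R m) :
    polyform R m :=
  \sum_(I : {set 'I_m} | j \notin I)
    monoform ((-1) ^+ nbelow j I * P I) (j |: I).

Definition dx_contr {R : realType} {m : nat} (j : 'I_m) (P : polyform R m) :
    polyform R m :=
  \sum_(I : {set 'I_m}) \sum_(i in I)
    monoform ((-1) ^+ nbelow i I * (j == i)%:R * P I) (I :\ i).

Definition partial {R : realType} {m : nat} (j : 'I_m) (P : polyform R m) :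
    polyform R m :=
  [ffun I => (P I)^`M(j)].

Definition mulx {R : realType} {m : nat} (j : 'I_m) (P : polyform R m) :
    polyform R m :=
  [ffun I => 'X_j * P I].

Definition d_op {R : realType} {m : nat} (P : polyform R m) : polyform R m :=
  \sum_(j < m) partial j (dx_wedge j P).

Definition dstar_op {R : realType} {m : nat} (P : polyform R m) : polyform R m :=
  - \sum_(j < m) partial j (dx_contr j P).

Definition x_op {R : realType} {m : nat} (P : polyform R m) : polyform R m :=
  - \sum_(j < m) mulx j (dx_wedge j P).

Definition xstar_op {R : realType} {m : nat} (P : polyform R m) : polyform R m :=
  \sum_(j < m) mulx j (dx_contr j P).

Definition homform {R : realType} {m : nat} (k : nat) (P : polyform R m) : Prop :=
  forall I : {set 'I_m}, P I \is k.-homog.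

Definition deg_form {R : realType} {m : nat} (s : nat) (P : polyform R m) : Prop :=
  forall I : {set 'I_m}, #|I| != s -> P I = 0.

Definition Hsp {R : realType} {m : nat} (s k : nat) (P : polyform R m) : Prop :=
  [/\ homform k P, deg_form s P, d_op P = 0 & dstar_op P = 0].

Definition Msp {R : realType} {m : nat} (k : nat) (P : polyform R m) : Prop :=
  homform k P /\ d_op P + dstar_op P = 0.

Definition image_sp {V : Type} (T : V -> V) (H : V -> Prop) (Q : V) : Prop :=
  exists2 P : V, H P & Q = T P.

(* Only used for k >= 1. *)
Definition Mpart {R : realType} {m : nat} (s k : nat) : polyform R m -> Prop :=
  image_sp
    (fun P => (k%:R - 1 + m%:R - s%:R) *: xstar_op P
              - (k%:R - 1 + s%:R) *: x_op P)
    (Hsp s k.-1).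

(* The value for k = 0 is irrelevant. *)
Definition Wpart {R : realType} {m : nat} (s k : nat) : polyform R m -> Prop :=
  if (2 <= k)%N then
    image_sp
      (fun P => (k%:R - 2 + m%:R - s%:R) *: x_op (xstar_op P)
                - (k%:R - 2 + s%:R) *: xstar_op (x_op P))
      (Hsp s k.-2)
  else fun P => P = 0.

Definition x_plus_xstar {R : realType} {m : nat} (P : polyform R m) : polyform R m :=
  x_op P + xstar_op P.

(* W is the internal direct sum of the family U. *)
Definition is_direct_sum {V : zmodType} {I : finType}
    (W : V -> Prop) (U : I -> V -> Prop) : Prop :=
  (forall w : V, W w <->
     exists u : I -> V, (forall i, U i (u i)) /\ w = \sum_i u i) /\
  (forall u v : I -> V, (forall i, U i (u i)) -> (forall i, U i (v i)) ->
     \sum_i u i = \sum_i v i -> forall i, u i = v i).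

(* Main.v *)
Require Import Defs.
From HB Require Import structures.
From mathcomp Require Import all_boot all_order all_algebra.
From mathcomp Require Import complex mpoly.
From mathcomp Require Import reals.
From mathcomp Require Import ring.
Set Implicit Arguments.
Unset Strict Implicit.
Unset Printing Implicit Defensive.
Import GRing.Theory Num.Theory.
Local Open Scope ring_scope.

(**
The contractions and exterior multiplications satisfy the Clifford-type
relations, so that the operators obey [{d, x^*} = k + s] and
[{d^*, x} = k + m - s] on forms of bidegree [(k, s)], while [{d, x}],
[{d^*, x^*}] and all four squares vanish, and [{x, x^*} = - r^2].

(a) For a monogenic [P], the form [Q = dP = - d^* P] is killed by [d] and
[d^*], so its components [Q_s] lie in [H^s_(k-1)]; moreover [Q_0 = Q_m = 0].
The generator [D_s = (k-1+m-s) x^* - (k-1+s) x] satisfies [d D_s h = c_s h] and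
[d^* D_s h = - c_s h] with [c_s = (k-1+m-s)(k-1+s)], which is nonzero for
[0 < s < m].  Hence [P] minus the sum of the [D_s (Q_s / c_s)] is killed by [d]
and [d^*].  Applying [d] to a vanishing sum gives uniqueness.

(b) The square of [x + x^*] is multiplication by [- r^2], so [x + x^*] is
injective and carries the decomposition (a) of order [k-1] to (b); for [k = 1]
the space [M_0] consists of all constant forms.
*)

(** * Clifford relations in the Grassmann algebra *)

Section Grassmann.
Context {R : realType} {m : nat}.
Implicit Types (P Q : polyform R m) (i j : 'I_m) (J : {set 'I_m}).

Lemma polyformDE P Q J : (P + Q) J = P J + Q J.
Proof. by rewrite ffunE. Qed.

Lemma polyformNE P J : (- P) J = - P J.
Proof. by rewrite ffunE. Qed.

Lemma polyform0E J : (0 : polyform R m) J = 0.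
Proof. by rewrite ffunE. Qed.

Lemma polyform_sumE (T : Type) (r : seq T) (p : pred T) (F : T -> polyform R m) J :
  (\sum_(t <- r | p t) F t) J = \sum_(t <- r | p t) F t J.
Proof. by rewrite sum_ffunE. Qed.

Lemma polyformMnE P n J : (P *+ n) J = P J *+ n.
Proof. by rewrite ffunMnE. Qed.

Lemma nbelowU1 i j J : i \notin J ->
  nbelow j (i |: J) = ((i < j) + nbelow j J)%N.
Proof.
move=> iJ; rewrite /nbelow.
have -> : [set l in i |: J | (l < j)%N] =
          if (i < j)%N then i |: [set l in J | (l < j)%N]
          else [set l in J | (l < j)%N].
  by case: ifP => ij; apply/setP=> l; rewrite !inE;
     case: eqVneq => [->|] //=; rewrite ij ?andbF ?(negbTE iJ).
by case: ifP => // _; rewrite cardsU1 !inE (negbTE iJ).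
Qed.

Lemma nbelowD1 i j J : i \in J ->
  nbelow j J = ((i < j) + nbelow j (J :\ i))%N.
Proof. by move=> iJ; rewrite -nbelowU1 ?setD1K // !inE eqxx. Qed.

(** Only the summand [I = J :\ j] reaches [J], and its sign can be read off [J] itself because [j]
    is not below [j]. *)
Lemma dx_wedgeE j P J :
  dx_wedge j P J = if j \in J then (-1) ^+ nbelow j J * P (J :\ j) else 0.
Proof.
rewrite /dx_wedge polyform_sumE; case: ifP => jJ; last first.
  rewrite big1 // => I _; rewrite ffunE; case: eqP => // E.
  by rewrite E !inE eqxx in jJ.
rewrite (bigD1 (J :\ j)) ?inE ?eqxx //= ffunE setD1K // eqxx big1 ?addr0.
  by rewrite [nbelow j J](nbelowD1 j jJ) ltnn.
move=> I /andP[jI IJ]; rewrite ffunE; case: eqP => // E.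
by rewrite E setU1K ?eqxx in IJ.
Qed.

(** The Kronecker factor collapses the inner sum to [i = j]; after that only [I = j |: J] reaches
    [J]. *)
Lemma dx_contrE j P J :
  dx_contr j P J = if j \in J then 0 else (-1) ^+ nbelow j J * P (j |: J).
Proof.
have -> : dx_contr j P =
    \sum_(I : {set 'I_m} | j \in I)
      monoform ((-1) ^+ nbelow j I * P I) (I :\ j).
  rewrite /dx_contr [RHS]big_mkcond; apply: eq_bigr => I _; case: ifP => jI.
    rewrite (bigD1 j) //= eqxx mulr1 big1 ?addr0 // => i /andP[_ ij].
    rewrite eq_sym (negbTE ij) mulr0 mul0r.
    by apply/ffunP=> J'; rewrite !ffunE if_same.
  apply: big1 => i iI; case: eqVneq => [ji|_]; first by rewrite ji iI in jI.
  by rewrite mulr0 mul0r; apply/ffunP=> J'; rewrite !ffunE if_same.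
rewrite polyform_sumE; case: ifP => jJ.
  rewrite big1 // => I _; rewrite ffunE; case: eqP => // E.
  by rewrite E !inE eqxx in jJ.
rewrite (bigD1 (j |: J)) ?inE ?eqxx //= ffunE setU1K ?jJ // eqxx big1 ?addr0.
  by rewrite nbelowU1 ?jJ // ltnn.
move=> I /andP[jI IJ]; rewrite ffunE; case: eqP => // E.
by rewrite E setD1K ?eqxx in IJ.
Qed.

(** Source of every anticommutation: for distinct indices exactly one of [i < j] and [j < i] holds,
    so exchanging them changes the parity of the exponent by one. *)
Lemma sign_swap i j (a b : nat) : i != j ->
  (-1) ^+ ((j < i) + a) * (-1) ^+ b =
  - ((-1) ^+ ((i < j) + b) * (-1) ^+ a) :> {mpoly R[i][m]}.
Proof.
move=> ij; rewrite !exprD.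
by case: ltngtP (ij : i != j :> nat) => //= _ _; rewrite !expr0 expr1; ring.
Qed.

Lemma dx_wedgeC i j P :
  dx_wedge i (dx_wedge j P) + dx_wedge j (dx_wedge i P) = 0.
Proof.
apply/ffunP=> J; rewrite polyformDE polyform0E.
rewrite (congr2 +%R (dx_wedgeE i _ J) (dx_wedgeE j _ J)) !dx_wedgeE !inE.
case: (eqVneq i j) => [<-|ij] /=; first by rewrite mulr0 if_same addr0.
case iJ: (i \in J); case jJ: (j \in J); rewrite ?mulr0 ?addr0 //=.
rewrite [J :\ j :\ i]setDDl [J :\ i :\ j]setDDl setUC !mulrA -mulrDl.
by rewrite [nbelow i J](nbelowD1 i jJ) [nbelow j J](nbelowD1 j iJ)
  (sign_swap _ _ ij) addNr mul0r.
Qed.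

Lemma dx_contrC i j P :
  dx_contr i (dx_contr j P) + dx_contr j (dx_contr i P) = 0.
Proof.
apply/ffunP=> J; rewrite polyformDE polyform0E.
rewrite (congr2 +%R (dx_contrE i _ J) (dx_contrE j _ J)) !dx_contrE !inE.
case: (eqVneq i j) => [<-|ij] /=; first by rewrite mulr0 if_same addr0.
case iJ: (i \in J); case jJ: (j \in J); rewrite ?mulr0 ?addr0 //=.
rewrite setUCA !mulrA -mulrDl !nbelowU1 ?iJ ?jJ //.
rewrite [X in (_ + X) * _]mulrC (sign_swap _ _ ij).
by rewrite [X in (_ - X) * _]mulrC subrr mul0r.
Qed.

(** For [i = j] exactly one of the two terms survives, according to whether [i] lies in [J], and its
    sign is squared. For [i != j] both terms vanish unless [i] is in [J] and [j] is not, and then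
    they cancel. *)
Lemma dx_wedge_contr i j P :
  dx_wedge i (dx_contr j P) + dx_contr j (dx_wedge i P) = P *+ (i == j).
Proof.
apply/ffunP=> J; rewrite polyformDE dx_wedgeE !dx_contrE dx_wedgeE polyformMnE.
case: (eqVneq i j) => [<-|ij] /=.
  rewrite !inE eqxx /=; case: ifP => iJ.
    rewrite addr0 mulrA setD1K // [nbelow i J](nbelowD1 i iJ) ltnn add0n.
    by rewrite -expr2 sqrr_sign mul1r.
  by rewrite add0r mulrA setU1K ?iJ // nbelowU1 ?iJ // ltnn -expr2 sqrr_sign mul1r.
rewrite !inE [j == i]eq_sym (negbTE ij) /=.
case iJ: (i \in J); case jJ: (j \in J); rewrite ?mulr0 ?addr0 //=.
have -> : (j |: J) :\ i = j |: (J :\ i).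
  apply/setP=> l; rewrite !inE; case: (eqVneq l j) => [->|_] //=.
  by rewrite eq_sym ij.
rewrite !mulrA -mulrDl [nbelow j J](nbelowD1 j iJ) nbelowU1 ?jJ //.
(* The swap leaves the indicator of [j < i] twice in the exponent, where it no longer affects the
   sign. *)
rewrite eq_sym in ij; rewrite [X in (_ + X) * _](sign_swap _ _ ij) addnA addnn.
by rewrite exprD -mul2n exprM sqrrN expr1n expr1n mul1r subrr mul0r.
Qed.

(** Number operator: each [j] in [J] contributes [P J] once, its two equal signs cancelling. It
    supplies the [s] in the constant [k + s]. *)
Lemma sum_dx_wedge_contr P J :
  (\sum_j dx_wedge j (dx_contr j P)) J = P J *+ #|J|.
Proof.
rewrite polyform_sumE -sumr_const [RHS]big_mkcond; apply: eq_bigr => j _.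
rewrite dx_wedgeE dx_contrE !inE eqxx; case: ifP => // jJ.
rewrite setD1K // mulrA [nbelow j J](nbelowD1 j jJ) ltnn add0n.
by rewrite -expr2 sqrr_sign mul1r.
Qed.

(** Summing the diagonal Clifford relation over the [m] indices makes this the complement of the
    number operator. *)
Lemma sum_dx_contr_wedge P J :
  (\sum_j dx_contr j (dx_wedge j P)) J = P J *+ (m - #|J|).
Proof.
have -> : \sum_j dx_contr j (dx_wedge j P) =
          P *+ m - \sum_j dx_wedge j (dx_contr j P).
  rewrite -[m in _ *+ m]card_ord -sumr_const -sumrB; apply: eq_bigr => j _.
  by apply/eqP; rewrite eq_sym subr_eq addrC dx_wedge_contr eqxx mulr1n.
rewrite polyformDE polyformNE polyformMnE sum_dx_wedge_contr mulrnBr //.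
by rewrite -[m in (_ <= m)%N]card_ord max_card.
Qed.

End Grassmann.

(** * Linearity, and commutation of derivatives, multiplications, wedges and contractions *)

Section Operators.
Context {R : realType} {m : nat}.
Implicit Types (P Q : polyform R m) (i j : 'I_m) (J : {set 'I_m}).

Lemma polyformZE (c : R[i]) P J : (c *: P) J = c *: P J.
Proof. by rewrite ffunE. Qed.

Lemma partialE i P J : partial i P J = (P J)^`M(i).
Proof. by rewrite ffunE. Qed.

Lemma mulxE i P J : mulx i P J = 'X_i * P J.
Proof. by rewrite ffunE. Qed.

Lemma partial_is_linear i : linear (@partial R m i).
Proof.
move=> c P Q; apply/ffunP=> J; rewrite polyformDE polyformZE !partialE.
by rewrite polyformDE polyformZE linearP.
Qed.

HB.instance Definition _ i :=
  GRing.isLinear.Build R[i] (polyform R m) (polyform R m) _ (partial i)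
    (partial_is_linear i).

Lemma mulx_is_linear i : linear (@mulx R m i).
Proof.
move=> c P Q; apply/ffunP=> J; rewrite polyformDE polyformZE !mulxE.
by rewrite polyformDE polyformZE mulrDr scalerAr.
Qed.

HB.instance Definition _ i :=
  GRing.isLinear.Build R[i] (polyform R m) (polyform R m) _ (mulx i)
    (mulx_is_linear i).

Lemma dx_wedge_is_linear i : linear (@dx_wedge R m i).
Proof.
move=> c P Q; apply/ffunP=> J; rewrite polyformDE polyformZE !dx_wedgeE.
case: ifP => _; last by rewrite scaler0 addr0.
by rewrite polyformDE polyformZE mulrDr scalerAr.
Qed.

HB.instance Definition _ i :=
  GRing.isLinear.Build R[i] (polyform R m) (polyform R m) _ (dx_wedge i)
    (dx_wedge_is_linear i).

Lemma dx_contr_is_linear i : linear (@dx_contr R m i).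
Proof.
move=> c P Q; apply/ffunP=> J; rewrite polyformDE polyformZE !dx_contrE.
case: ifP => _; first by rewrite scaler0 addr0.
by rewrite polyformDE polyformZE mulrDr scalerAr.
Qed.

HB.instance Definition _ i :=
  GRing.isLinear.Build R[i] (polyform R m) (polyform R m) _ (dx_contr i)
    (dx_contr_is_linear i).

Lemma mderiv_sign i n (p : {mpoly R[i][m]}) :
  ((-1) ^+ n * p)^`M(i) = (-1) ^+ n * p^`M(i).
Proof. by rewrite -signr_odd !mulr_sign; case: odd; rewrite ?mderivN. Qed.

Lemma partial_wedge i j P : partial i (dx_wedge j P) = dx_wedge j (partial i P).
Proof.
apply/ffunP=> J; rewrite partialE !dx_wedgeE partialE.
by case: ifP => _; rewrite ?mderiv_sign ?mderiv0.
Qed.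

Lemma partial_contr i j P : partial i (dx_contr j P) = dx_contr j (partial i P).
Proof.
apply/ffunP=> J; rewrite partialE !dx_contrE partialE.
by case: ifP => _; rewrite ?mderiv_sign ?mderiv0.
Qed.

Lemma mulx_wedge i j P : mulx i (dx_wedge j P) = dx_wedge j (mulx i P).
Proof.
apply/ffunP=> J; rewrite mulxE !dx_wedgeE mulxE.
by case: ifP => _; rewrite ?mulr0 // mulrCA.
Qed.

Lemma mulx_contr i j P : mulx i (dx_contr j P) = dx_contr j (mulx i P).
Proof.
apply/ffunP=> J; rewrite mulxE !dx_contrE mulxE.
by case: ifP => _; rewrite ?mulr0 // mulrCA.
Qed.

Lemma partialC i j P : partial i (partial j P) = partial j (partial i P).
Proof. by apply/ffunP=> J; rewrite !partialE mderiv_comm. Qed.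

Lemma mulxC i j P : mulx i (mulx j P) = mulx j (mulx i P).
Proof. by apply/ffunP=> J; rewrite !mulxE mulrCA. Qed.

Lemma partial_mulx i j P :
  partial i (mulx j P) = mulx j (partial i P) + P *+ (i == j).
Proof.
apply/ffunP=> J; rewrite polyformDE polyformMnE !(partialE, mulxE) mderivM.
rewrite mderivX mnm1E eq_sym addrC; congr (_ + _).
case: eqVneq => [->|_]; last by rewrite scale0r mul0r mulr0n.
(* The derivative of ['X_j] comes out as a monomial with exponent [U_(j) - U_(j)], that is, the
   constant 1. *)
suff -> : (U_(j) - U_(j) = 0 :> 'X_{1..m})%MM by rewrite mpolyX0 scale1r mul1r.
by apply/mnmP=> l; rewrite mnmBE mnm0E subnn.
Qed.

Lemma polyform_double0 P : P + P = 0 -> P = 0.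
Proof.
rewrite -mulr2n -scaler_nat => /eqP; rewrite scaler_eq0 => /orP[|/eqP //].
by rewrite pnatr_eq0.
Qed.

(** * Anticommutators for two generic Clifford families *)

Section Families.
Context (A B : 'I_m -> {linear (polyform R m) -> (polyform R m)}) (c : bool).
Context (AB : forall i j P, A i (B j P) + B j (A i P) = P *+ (c && (i == j))).
Context (pA : forall i j P, partial i (A j P) = A j (partial i P)).
Context (pB : forall i j P, partial i (B j P) = B j (partial i P)).
Context (xA : forall i j P, mulx i (A j P) = A j (mulx i P)).
Context (xB : forall i j P, mulx i (B j P) = B j (mulx i P)).

(** Each of [A] and [B] stands for the wedges or the contractions, and [c] is true for a mixed pair.
    Derivatives commute, so the pair [i], [j] contributes the anticommutator of [A i] and [B j],
    which leaves at most the diagonal. *)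
Lemma partial_family_comm P :
  \sum_i partial i (A i (\sum_j partial j (B j P))) +
  \sum_j partial j (B j (\sum_i partial i (A i P))) =
  (\sum_i partial i (partial i P)) *+ c.
Proof.
under eq_bigr do rewrite !linear_sum.
under [X in _ + X]eq_bigr do rewrite !linear_sum.
rewrite [X in _ + X]exchange_big -big_split -sumrMnl; apply: eq_bigr => i _ /=.
rewrite -big_split (bigD1 i) //= big1 ?addr0 => [|j ji].
  by rewrite -!(pA, pB) -!linearD /= AB eqxx andbT !linearMn.
by rewrite -!(pA, pB) [partial j (partial _ _)]partialC
  -!linearD /= AB eq_sym (negbTE ji)
  andbF !linear0.
Qed.

Lemma mulx_family_comm P :
  \sum_i mulx i (A i (\sum_j mulx j (B j P))) +
  \sum_j mulx j (B j (\sum_i mulx i (A i P))) =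
  (\sum_i mulx i (mulx i P)) *+ c.
Proof.
under eq_bigr do rewrite !linear_sum.
under [X in _ + X]eq_bigr do rewrite !linear_sum.
rewrite [X in _ + X]exchange_big -big_split -sumrMnl; apply: eq_bigr => i _ /=.
rewrite -big_split (bigD1 i) //= big1 ?addr0 => [|j ji].
  by rewrite -!(xA, xB) -!linearD /= AB eqxx andbT !linearMn.
by rewrite -!(xA, xB) [mulx j (mulx _ _)]mulxC
  -!linearD /= AB eq_sym (negbTE ji)
  andbF !linear0.
Qed.

(** Moving [partial i] past [mulx i] adds the diagonal terms [A i (B i P)], later a number operator;
    the Clifford relation turns the rest into the Euler operator for a mixed pair. *)
Lemma partial_mulx_family_comm P :
  \sum_i partial i (A i (\sum_j mulx j (B j P))) +
  \sum_j mulx j (B j (\sum_i partial i (A i P))) =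
  \sum_i A i (B i P) + (\sum_i mulx i (partial i P)) *+ c.
Proof.
under eq_bigr do rewrite !linear_sum.
under [X in _ + X]eq_bigr do rewrite !linear_sum.
rewrite [X in _ + X]exchange_big -big_split -sumrMnl -big_split.
apply: eq_bigr => i _ /=; rewrite -big_split (bigD1 i) //= big1 ?addr0.
  rewrite -!(xA, xB, pA, pB) partial_mulx eqxx mulr1n addrAC.
  by rewrite -!linearD /= AB eqxx andbT !linearMn addrC.
move=> j ji; rewrite -!(xA, xB, pA, pB) partial_mulx eq_sym (negbTE ji) addr0.
by rewrite -!linearD /= AB eq_sym (negbTE ji) andbF !linear0.
Qed.

End Families.

End Operators.

(** * Relations between [d_op], [dstar_op], [x_op] and [xstar_op] *)

Section Relations.
Context {R : realType} {m : nat}.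
Implicit Types (P Q : polyform R m) (i j : 'I_m) (J : {set 'I_m}).

(** Wedges and contractions bundled with their linear structure, the form in which the generic
    family lemmas take them. *)
Let W i : {linear (polyform R m) -> (polyform R m)} := dx_wedge i.
Let C i : {linear (polyform R m) -> (polyform R m)} := dx_contr i.

Lemma wedge_wedge i j P : W i (W j P) + W j (W i P) = P *+ (false && (i == j)).
Proof. exact: dx_wedgeC. Qed.

Lemma contr_contr i j P : C i (C j P) + C j (C i P) = P *+ (false && (i == j)).
Proof. exact: dx_contrC. Qed.

Lemma wedge_contr i j P : W i (C j P) + C j (W i P) = P *+ (true && (i == j)).
Proof. exact: dx_wedge_contr. Qed.

Lemma contr_wedge i j P : C i (W j P) + W j (C i P) = P *+ (true && (i == j)).
Proof. by rewrite addrC eq_sym; exact: dx_wedge_contr. Qed.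

Lemma d_op_is_linear : linear (@d_op R m).
Proof.
move=> c P Q; rewrite /d_op scaler_sumr -big_split; apply: eq_bigr => i _ /=.
by rewrite (linearP (dx_wedge i)) (linearP (partial i)).
Qed.

HB.instance Definition _ :=
  GRing.isLinear.Build R[i] (polyform R m) (polyform R m) _ d_op d_op_is_linear.

Lemma dstar_op_is_linear : linear (@dstar_op R m).
Proof.
move=> c P Q; rewrite /dstar_op scalerN -opprD scaler_sumr -big_split.
by congr (- _); apply: eq_bigr => i _ /=;
  rewrite (linearP (dx_contr i)) (linearP (partial i)).
Qed.

HB.instance Definition _ :=
  GRing.isLinear.Build R[i] (polyform R m) (polyform R m) _ dstar_op
    dstar_op_is_linear.

Lemma x_op_is_linear : linear (@x_op R m).
Proof.
move=> c P Q; rewrite /x_op scalerN -opprD scaler_sumr -big_split.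
by congr (- _); apply: eq_bigr => i _ /=;
  rewrite (linearP (dx_wedge i)) (linearP (mulx i)).
Qed.

HB.instance Definition _ :=
  GRing.isLinear.Build R[i] (polyform R m) (polyform R m) _ x_op x_op_is_linear.

Lemma xstar_op_is_linear : linear (@xstar_op R m).
Proof.
move=> c P Q; rewrite /xstar_op scaler_sumr -big_split; apply: eq_bigr => i _ /=.
by rewrite (linearP (dx_contr i)) (linearP (mulx i)).
Qed.

HB.instance Definition _ :=
  GRing.isLinear.Build R[i] (polyform R m) (polyform R m) _ xstar_op
    xstar_op_is_linear.

Lemma x_plus_xstar_is_linear : linear (@x_plus_xstar R m).
Proof. by move=> c P Q; rewrite /x_plus_xstar !linearP scalerDr addrACA. Qed.

HB.instance Definition _ :=
  GRing.isLinear.Build R[i] (polyform R m) (polyform R m) _ x_plus_xstar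
    x_plus_xstar_is_linear.

(** For two equal families the anticommutator is twice the square, and [c = false] makes it vanish.
    The other three squares follow the same way. *)
Lemma d_opK P : d_op (d_op P) = 0.
Proof.
apply: polyform_double0.
by rewrite [LHS](partial_family_comm wedge_wedge partial_wedge partial_wedge).
Qed.

Lemma dstar_opK P : dstar_op (dstar_op P) = 0.
Proof.
apply: polyform_double0; rewrite [X in X + X]linearN /= opprK.
by rewrite [LHS](partial_family_comm contr_contr partial_contr partial_contr).
Qed.

Lemma x_opK P : x_op (x_op P) = 0.
Proof.
apply: polyform_double0; rewrite [X in X + X]linearN /= opprK.
by rewrite [LHS](mulx_family_comm wedge_wedge mulx_wedge mulx_wedge).
Qed.

Lemma xstar_opK P : xstar_op (xstar_op P) = 0.
Proof.
apply: polyform_double0.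
by rewrite [LHS](mulx_family_comm contr_contr mulx_contr mulx_contr).
Qed.

Lemma x_op_xstar_op P :
  x_op (xstar_op P) + xstar_op (x_op P) = - \sum_i mulx i (mulx i P).
Proof.
rewrite [X in _ + X]linearN -opprD; congr (- _).
exact: (mulx_family_comm wedge_contr mulx_wedge mulx_contr).
Qed.

(** Both families are wedges, so no Euler term appears, and the leftover diagonal consists of
    squares of wedges, which vanish. *)
Lemma d_op_x_op P : d_op (x_op P) = - x_op (d_op P).
Proof.
apply/eqP; rewrite -addr_eq0 linearN -opprD oppr_eq0; apply/eqP.
rewrite [LHS](partial_mulx_family_comm wedge_wedge partial_wedge mulx_wedge) addr0.
apply: big1 => i _; apply: polyform_double0; exact: dx_wedgeC.
Qed.

Lemma dstar_op_xstar_op P : dstar_op (xstar_op P) = - xstar_op (dstar_op P).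
Proof.
apply/eqP; rewrite -addr_eq0 linearN -opprD oppr_eq0; apply/eqP.
rewrite [LHS](partial_mulx_family_comm contr_contr partial_contr mulx_contr) addr0.
apply: big1 => i _; apply: polyform_double0; exact: dx_contrC.
Qed.

Lemma mpolyX_euler i (n : 'X_{1..m}) :
  'X_i * ('X_[n] : {mpoly R[i][m]})^`M(i) = (n i)%:R *: 'X_[n].
Proof.
(* Exponent subtraction truncates, so multiplying by ['X_i] undoes it only for positive [n i];
   otherwise the scalar factor is zero. *)
rewrite mderivX -scalerAr -mpolyXD; case: (posnP (n i)) => [->|ni].
  by rewrite !scale0r.
by rewrite addmC submK //; apply/mnm_lepP => l; rewrite mnm1E; case: eqP => // <-.
Qed.

(** By linearity this reduces to monomials, where the exponents add up to the degree [k]. *)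
Lemma euler k (p : {mpoly R[i][m]}) :
  p \is k.-homog -> \sum_i 'X_i * p^`M(i) = k%:R *: p.
Proof.
move=> /dhomogP hp; rewrite {2}[p]mpolyE scaler_sumr.
transitivity (\sum_(n <- msupp p) \sum_i p@_n *: ('X_i * ('X_[n])^`M(i))).
  rewrite exchange_big; apply: eq_bigr => i _ /=.
  rewrite {1}[p]mpolyE linear_sum mulr_sumr; apply: eq_bigr => n _.
  by rewrite linearZ -scalerAr.
rewrite !big_seq; apply: eq_bigr => n np.
under eq_bigr do rewrite mpolyX_euler scalerA mulrC.
by rewrite -scaler_suml -mulr_suml -natr_sum -mdegE (hp n np) scalerA.
Qed.

Lemma sum_mulx_partial k P : homform k P ->
  \sum_i mulx i (partial i P) = k%:R *: P.
Proof.
move=> hP; apply/ffunP=> J; rewrite polyform_sumE polyformZE -(euler (hP J)).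
by apply: eq_bigr => i _; rewrite mulxE partialE.
Qed.

(** The Euler operator contributes [k] and the number operator contributes [s]. *)
Lemma d_op_xstar_op k s P : homform k P -> deg_form s P ->
  d_op (xstar_op P) + xstar_op (d_op P) = (k + s)%:R *: P.
Proof.
move=> hP dP.
rewrite [LHS](partial_mulx_family_comm wedge_contr partial_contr mulx_wedge)
  (sum_mulx_partial hP) natrD scalerDl addrC.
congr (_ + _); apply/ffunP=> J; rewrite sum_dx_wedge_contr polyformZE.
by case: (eqVneq #|J| s) => [->|/dP->]; rewrite scaler_nat ?mul0rn.
Qed.

(** The minus signs of [dstar_op] and [x_op] cancel; the complementary number operator contributes
    [m - s]. *)
Lemma dstar_op_x_op k s P : homform k P -> deg_form s P ->
  dstar_op (x_op P) + x_op (dstar_op P) = (k + (m - s))%:R *: P.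
Proof.
move=> hP dP; rewrite [dstar_op (x_op P)]linearN [x_op (dstar_op P)]linearN /=
  !opprK.
rewrite [LHS](partial_mulx_family_comm contr_wedge partial_wedge mulx_contr)
  (sum_mulx_partial hP) natrD scalerDl addrC.
congr (_ + _); apply/ffunP=> J; rewrite sum_dx_contr_wedge polyformZE.
by case: (eqVneq #|J| s) => [->|/dP->]; rewrite scaler_nat ?mul0rn.
Qed.

Lemma x_plus_xstarK P :
  x_plus_xstar (x_plus_xstar P) = - \sum_i mulx i (mulx i P).
Proof.
rewrite /x_plus_xstar (linearD x_op) (linearD xstar_op) /=.
by rewrite x_opK xstar_opK add0r addr0 x_op_xstar_op.
Qed.

(** Applying the map twice multiplies every coefficient by minus the sum of the squared variables, a
    nonzero element of an integral domain. *)
Lemma x_plus_xstar_inj : (0 < m)%N -> injective (@x_plus_xstar R m).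
Proof.
move=> hm; apply: raddf_inj => P /(congr1 x_plus_xstar).
rewrite x_plus_xstarK linear0 => /eqP; rewrite oppr_eq0 => /eqP PE.
apply/ffunP=> J; have := congr1 (fun Q : polyform R m => Q J) PE.
have -> : (\sum_i mulx i (mulx i P)) J =
          (\sum_i 'X_i * 'X_i) * P J :> {mpoly R[i][m]}.
  rewrite polyform_sumE mulr_suml; apply: eq_bigr => i _.
  by rewrite !mulxE mulrA.
rewrite !polyform0E => /eqP; rewrite mulf_eq0 => /orP[|/eqP //].
(* At the point with all coordinates 1 the sum of squares takes the value [m], which is nonzero. *)
move=> /eqP /(congr1 (meval (fun _ => 1))).
rewrite meval0 rmorph_sum; under eq_bigr do rewrite rmorphM /= mevalXU mulr1.
by rewrite sumr_const card_ord => /eqP; rewrite pnatr_eq0 eqn0Ngt hm.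
Qed.

End Relations.

(** * Components of a form by exterior degree *)

Definition deg_restr {R : realType} {m : nat} (a : pred nat)
    (P : polyform R m) : polyform R m :=
  [ffun J : {set 'I_m} => if a #|J| then P J else 0].

Notation deg_proj s := (deg_restr (@pred1 nat s)).

Section Degrees.
Context {R : realType} {m : nat}.
Implicit Types (P Q : polyform R m) (i j : 'I_m) (J : {set 'I_m}).

Lemma deg_restrE a P J : deg_restr a P J = if a #|J| then P J else 0.
Proof. by rewrite ffunE. Qed.

Lemma deg_restr_is_linear a : linear (@deg_restr R m a).
Proof.
move=> c P Q; apply/ffunP=> J; rewrite polyformDE polyformZE !deg_restrE.
by case: ifP => _; rewrite ?scaler0 ?addr0 // polyformDE polyformZE.
Qed.

HB.instance Definition _ a :=
  GRing.isLinear.Build R[i] (polyform R m) (polyform R m) _ (deg_restr a)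
    (deg_restr_is_linear a).

Lemma deg_restr_partial a i P : deg_restr a (partial i P) = partial i (deg_restr a P).
Proof.
apply/ffunP=> J; rewrite partialE !deg_restrE partialE.
by case: ifP => _; rewrite ?mderiv0.
Qed.

(** A set [J] reached by a wedge contains [i], so the convention [0.-1 = 0] does no harm. *)
Lemma dx_wedge_deg_restr a i P :
  dx_wedge i (deg_restr a P) = deg_restr (fun n => a n.-1) (dx_wedge i P).
Proof.
apply/ffunP=> J; rewrite deg_restrE !dx_wedgeE deg_restrE.
case: (boolP (i \in J)) => [iJ|_]; last by rewrite if_same.
by rewrite [#|J|](cardsD1 i) iJ /=; case: ifP; rewrite ?mulr0.
Qed.

Lemma dx_contr_deg_restr a i P :
  dx_contr i (deg_restr a P) = deg_restr (fun n => a n.+1) (dx_contr i P).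
Proof.
apply/ffunP=> J; rewrite deg_restrE !dx_contrE deg_restrE.
case: (boolP (i \in J)) => [_|iJ]; first by rewrite if_same.
by rewrite cardsU1 iJ; case: ifP; rewrite ?mulr0.
Qed.

Lemma d_op_deg_restr a P :
  d_op (deg_restr a P) = deg_restr (fun n => a n.-1) (d_op P).
Proof.
rewrite /d_op linear_sum; apply: eq_bigr => i _ /=.
by rewrite dx_wedge_deg_restr deg_restr_partial.
Qed.

Lemma dstar_op_deg_restr a P :
  dstar_op (deg_restr a P) = deg_restr (fun n => a n.+1) (dstar_op P).
Proof.
rewrite /dstar_op [RHS]linearN; congr (- _); rewrite linear_sum.
apply: eq_bigr => i _ /=.
by rewrite dx_contr_deg_restr deg_restr_partial.
Qed.

Lemma deg_form_proj s P : deg_form s (deg_proj s P).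
Proof. by move=> J /negbTE Js; rewrite deg_restrE /= Js. Qed.

Lemma deg_proj_form s t P : deg_form t P -> deg_proj s P = P *+ (s == t).
Proof.
move=> dP; apply/ffunP=> J; rewrite deg_restrE polyformMnE /=.
case: (eqVneq #|J| s) => [Js|Js]; last first.
  case: (eqVneq s t) => [E|_]; last by rewrite mulr0n.
  by rewrite dP ?mul0rn // -E.
case: (eqVneq s t) => [_|st]; first by rewrite mulr1n.
by rewrite mulr0n dP // Js.
Qed.

Lemma sum_deg_proj P : \sum_(s < m.+1) deg_proj s P = P.
Proof.
apply/ffunP=> J; rewrite polyform_sumE.
have Jm : (#|J| < m.+1)%N by rewrite ltnS -[m in (_ <= m)%N]card_ord max_card.
rewrite (bigD1 (Ordinal Jm)) //= big1 ?addr0 ?deg_restrE /= ?eqxx // => s.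
by rewrite -val_eqE deg_restrE /= eq_sym => /negbTE ->.
Qed.

Lemma sum_deg_form_eq0 (h : 'I_m.+1 -> polyform R m) :
  (forall s : 'I_m.+1, deg_form s (h s)) -> \sum_s h s = 0 -> forall s, h s = 0.
Proof.
move=> hd h0 s; move: (congr1 (deg_proj s) h0).
rewrite linear_sum linear0 (bigD1 s) //= (deg_proj_form _ (hd s)) eqxx mulr1n.
rewrite big1 ?addr0 // => t ts; rewrite (deg_proj_form _ (hd t)).
by rewrite eq_sym (negbTE (ts : t != s :> nat)) mulr0n.
Qed.

(** No index belongs to the empty set, so no wedge reaches it; dually, no contraction reaches the
    full set. *)
Lemma deg_proj0_d_op P : deg_proj 0 (d_op P) = 0.
Proof.
apply/ffunP=> J; rewrite deg_restrE polyform0E /=; case: eqP => // /cards0_eq ->.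
rewrite polyform_sumE big1 // => i _.
by rewrite partialE dx_wedgeE inE mderiv0.
Qed.

Lemma deg_projm_dstar_op P : deg_proj m (dstar_op P) = 0.
Proof.
apply/ffunP=> J; rewrite deg_restrE polyform0E /=; case: eqP => // Jm.
have -> : J = setT.
  by apply/eqP; rewrite eqEcard subsetT cardsT card_ord Jm leqnn.
rewrite polyformNE polyform_sumE big1 ?oppr0 // => i _.
by rewrite partialE dx_contrE inE mderiv0.
Qed.

End Degrees.

(** * Polynomial degree of forms *)

Section Homogeneity.
Context {R : realType} {m : nat}.
Implicit Types (P Q : polyform R m) (i j : 'I_m) (J : {set 'I_m}).

Lemma homform0 k : homform k (0 : polyform R m).
Proof. by move=> J; rewrite polyform0E; exact: rpred0. Qed.

Lemma homformD k P Q : homform k P -> homform k Q -> homform k (P + Q).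
Proof. by move=> hP hQ J; rewrite polyformDE; exact: rpredD. Qed.

Lemma homformN k P : homform k P -> homform k (- P).
Proof. by move=> hP J; rewrite polyformNE rpredN. Qed.

Lemma homformB k P Q : homform k P -> homform k Q -> homform k (P - Q).
Proof. by move=> hP /homformN; exact: homformD. Qed.

Lemma homformZ k (c : R[i]) P : homform k P -> homform k (c *: P).
Proof. by move=> hP J; rewrite polyformZE; exact: rpredZ. Qed.

Lemma homform_sum k (I : finType) (F : I -> polyform R m) :
  (forall t, homform k (F t)) -> homform k (\sum_t F t).
Proof.
by move=> hF J; rewrite polyform_sumE; apply: rpred_sum => t _; exact: hF.
Qed.

Lemma homform_deg_restr k a P : homform k P -> homform k (deg_restr a P).
Proof.
by move=> hP J; rewrite deg_restrE; case: ifP => // _; exact: rpred0.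
Qed.

Lemma sign_homog k n (p : {mpoly R[i][m]}) :
  p \is k.-homog -> (-1) ^+ n * p \is k.-homog.
Proof. by rewrite -signr_odd mulr_sign => hp; case: odd; rewrite ?rpredN. Qed.

Lemma homform_wedge k i P : homform k P -> homform k (dx_wedge i P).
Proof.
move=> hP J; rewrite dx_wedgeE; case: ifP => _; last exact: rpred0.
exact: sign_homog.
Qed.

Lemma homform_contr k i P : homform k P -> homform k (dx_contr i P).
Proof.
move=> hP J; rewrite dx_contrE; case: ifP => _; first exact: rpred0.
exact: sign_homog.
Qed.

Lemma homform_mulx k i P : homform k P -> homform k.+1 (mulx i P).
Proof.
move=> hP J; rewrite mulxE -add1n; apply: dhomogM => //.
by rewrite dhomogX /= mdeg1.
Qed.

(** At [k = 0] the derivative is zero, which is homogeneous of every degree, so the truncated [k.-1]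
    is correct there too. *)
Lemma homform_partial k i P : homform k P -> homform k.-1 (partial i P).
Proof.
move=> hP J; rewrite partialE; apply/dhomogP => n.
rewrite mcoeff_msupp mcoeff_mderiv => nz.
have /(dhomog_mf (hP J)) : (n + U_(i))%MM \in msupp (P J).
  by rewrite mcoeff_msupp; apply: contraNneq nz => ->; rewrite mul0rn.
by rewrite /= mdegD mdeg1 addn1 => <-.
Qed.

Lemma partial_homform0 i P : homform 0 P -> partial i P = 0.
Proof.
move=> hP; apply/ffunP=> J; rewrite partialE polyform0E; apply/mpolyP => n.
rewrite mcoeff_mderiv mcoeff0 (dhomog_nemf_coeff (hP J)) ?mul0rn //=.
by rewrite mdegD mdeg1 addn1.
Qed.

Lemma d_op_homform0 P : homform 0 P -> d_op P = 0.
Proof.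
by move=> hP; apply: big1 => i _; rewrite partial_homform0 //; exact: homform_wedge.
Qed.

Lemma dstar_op_homform0 P : homform 0 P -> dstar_op P = 0.
Proof.
move=> hP; rewrite /dstar_op big1 ?oppr0 // => i _.
by rewrite partial_homform0 //; exact: homform_contr.
Qed.

Lemma homform_d_op k P : homform k P -> homform k.-1 (d_op P).
Proof.
by move=> hP; apply: homform_sum => i; exact/homform_partial/homform_wedge.
Qed.

Lemma homform_x_op k P : homform k P -> homform k.+1 (x_op P).
Proof.
move=> hP; apply/homformN/homform_sum => i.
exact/homform_mulx/homform_wedge.
Qed.

Lemma homform_xstar_op k P : homform k P -> homform k.+1 (xstar_op P).
Proof.
by move=> hP; apply: homform_sum => i; exact/homform_mulx/homform_contr.
Qed.

End Homogeneity.

(** * General facts on internal direct sums *)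

Section DirectSums.

Lemma is_direct_sum_of_eq0 (V : zmodType) (I : finType)
    (W : V -> Prop) (U : I -> V -> Prop) :
  (forall w, W w <-> exists u, (forall i, U i (u i)) /\ w = \sum_i u i) ->
  (forall i x y, U i x -> U i y -> U i (x - y)) ->
  (forall u, (forall i, U i (u i)) -> \sum_i u i = 0 -> forall i, u i = 0) ->
  is_direct_sum W U.
Proof.
move=> WU UB U0; split=> // u v Uu Uv uv i.
apply/subr0_eq; apply: (U0 (fun i => u i - v i)) => [l|]; first exact: UB.
by rewrite sumrB uv subrr.
Qed.

(** Additivity transports the sums and injectivity pulls uniqueness back; with [f] equal to
    [x_plus_xstar] this derives (b) from (a). *)
Lemma is_direct_sum_image (V : zmodType) (f : {additive V -> V})
    (I : finType) (W : V -> Prop) (U : I -> V -> Prop) :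
  injective f -> is_direct_sum W U ->
  is_direct_sum (image_sp f W) (fun i => image_sp f (U i)).
Proof.
move=> finj [WU Uuniq]; split=> [w|u v Uu Uv uv i].
  split=> [[p /WU[u [Uu ->]] ->]|[u [Uu ->]]].
    by exists (f \o u); split; [move=> i; exists (u i)|exact: raddf_sum].
  (* As [I] is finite, preimages of all components can be picked simultaneously. *)
  have [p Up up] := fin_all_exists2 Uu.
  exists (\sum_i p i); first by apply/WU; exists p.
  by rewrite raddf_sum; apply: eq_bigr.
have [p Up up] := fin_all_exists2 Uu; have [q Uq vq] := fin_all_exists2 Uv.
rewrite up vq (Uuniq p q) //; apply: finj; rewrite !raddf_sum.
under eq_bigr do rewrite -up; under [RHS]eq_bigr do rewrite -vq.
exact: uv.
Qed.

Lemma eq_is_direct_sum (V : zmodType) (I : finType)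
    (W : V -> Prop) (U U' : I -> V -> Prop) :
  (forall i x, U i x <-> U' i x) -> is_direct_sum W U -> is_direct_sum W U'.
Proof.
move=> UU' [WU Uuniq]; split=> [w|u v Uu Uv].
  by rewrite WU; split=> -[u [Uu ->]]; exists u; split=> // i; apply/UU'.
by apply: Uuniq => i; apply/UU'.
Qed.

End DirectSums.

(** * Coefficients of the generators *)

Section Coefficients.
Context {A : pzRingType}.

(** Rewriting the scalar as a natural number lets it be compared with the constants of the
    anticommutators; [s <= m] keeps the subtraction from truncating. *)
Lemma Mgen_coefl s m k : (s <= m)%N ->
  k.+1%:R - 1 + m%:R - s%:R = (k + (m - s))%:R :> A.
Proof. by move=> sm; rewrite -natr1 addrK natrD natrB // addrA. Qed.

Lemma Mgen_coefr s k : k.+1%:R - 1 + s%:R = (k + s)%:R :> A.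
Proof. by rewrite -natr1 addrK natrD. Qed.

Lemma natrS_sub2 k : k.+2%:R - 2 = k.+1%:R - 1 :> A.
Proof. by rewrite -[k.+2%:R]natr1 -[2]natr1 opprD addrACA subrr addr0. Qed.

End Coefficients.

Lemma lin_comb_is_linear (A : comNzRingType) (V : lmodType A)
    (f g : {linear V -> V}) (a b : A) :
  linear (fun v => a *: f v - b *: g v).
Proof.
move=> c u v; rewrite (linearP f) (linearP g) !scalerDr opprD addrACA scalerN.
by rewrite !scalerA (mulrC a) (mulrC b).
Qed.

Lemma linear_lin_comb (A : pzRingType) (V : lmodType A) (f : {linear V -> V})
    (a b : A) (u v : V) :
  f (a *: u - b *: v) = a *: f u - b *: f v.
Proof. by rewrite linearB !linearZ. Qed.

(** * The spaces [Hsp] and [Msp], and the generators of [Mpart] *)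

Section Monogenic.
Context {R : realType} {m : nat}.
Implicit Types (P Q h : polyform R m).

Lemma HspB s k P Q : Hsp s k P -> Hsp s k Q -> Hsp s k (P - Q).
Proof.
move=> [hP gP dP sP] [hQ gQ dQ sQ]; split.
- exact: homformB.
- by move=> J Js; rewrite polyformDE polyformNE gP ?gQ ?subr0.
- by rewrite linearB /= dP dQ subr0.
- by rewrite linearB /= sP sQ subr0.
Qed.

Lemma HspZ s k (c : R[i]) P : Hsp s k P -> Hsp s k (c *: P).
Proof.
move=> [hP gP dP sP]; split.
- exact: homformZ.
- by move=> J Js; rewrite polyformZE gP ?scaler0.
- by rewrite linearZ /= dP scaler0.
- by rewrite linearZ /= sP scaler0.
Qed.

(** Both operators shift the exterior degree by one, so their vanishing passes to each component. *)
Lemma Hsp_deg_proj s k P : homform k P -> d_op P = 0 -> dstar_op P = 0 ->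
  Hsp s k (deg_proj s P).
Proof.
move=> hP dP sP; split; first exact: homform_deg_restr.
- exact: deg_form_proj.
- by rewrite d_op_deg_restr dP linear0.
- by rewrite dstar_op_deg_restr sP linear0.
Qed.

Lemma Hsp_sub_Msp s k P : Hsp s k P -> Msp k P.
Proof. by move=> [hP _ dP sP]; split; rewrite // dP sP addr0. Qed.

Lemma Msp_sum k (I : finType) (F : I -> polyform R m) :
  (forall t, Msp k (F t)) -> Msp k (\sum_t F t).
Proof.
move=> hF; split; first by apply: homform_sum => t; case: (hF t).
by rewrite !linear_sum -big_split; apply: big1 => t _; case: (hF t).
Qed.

Definition Mgen s k P : polyform R m :=
  (k%:R - 1 + m%:R - s%:R) *: xstar_op P - (k%:R - 1 + s%:R) *: x_op P.

Lemma MgenE s k P : (s <= m)%N ->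
  Mgen s k.+1 P = (k + (m - s))%:R *: xstar_op P - (k + s)%:R *: x_op P.
Proof.
move=> sm; rewrite /Mgen; set a := (X in X *: _ - _); set b := (X in _ - X *: _).
have -> : a = (k + (m - s))%:R by apply: Mgen_coefl.
by have -> : b = (k + s)%:R by apply: Mgen_coefr.
Qed.

Lemma Mgen_is_linear s k : linear (Mgen s k).
Proof. exact: lin_comb_is_linear. Qed.

HB.instance Definition _ s k :=
  GRing.isLinear.Build R[i] (polyform R m) (polyform R m) _ (Mgen s k)
    (Mgen_is_linear s k).

Lemma homform_Mgen s k P : homform k P -> homform k.+1 (Mgen s k.+1 P).
Proof.
by move=> hP; apply: homformB; apply: homformZ;
  [exact: homform_xstar_op | exact: homform_x_op].
Qed.

(** The constant [c_s], with [k] in the place of [k - 1]. *)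
Definition Mcoef s k : R[i] := ((k + s) * (k + (m - s)))%:R.

(** One factor is positive because of [0 < s], the other because of [s < m], even when [k = 0]. *)
Lemma Mcoef_neq0 s k : (0 < s < m)%N -> Mcoef s k != 0.
Proof.
move=> /andP[s0 sm]; rewrite pnatr_eq0 muln_eq0 !addn_eq0 subn_eq0.
by rewrite [s == 0%N]eqn0Ngt s0 [(m <= s)%N]leqNgt sm !andbF.
Qed.

(** Since [d h = 0], the anticommutator with [xstar_op] acts as the scalar [k + s], while the [x_op]
    term is killed. *)
Lemma d_op_Mgen s k h : (s <= m)%N -> Hsp s k h ->
  d_op (Mgen s k.+1 h) = Mcoef s k *: h.
Proof.
move=> sm [hh gh dh sh].
have dxs : d_op (xstar_op h) = (k + s)%:R *: h.
  by rewrite -(d_op_xstar_op hh gh) dh (linear0 xstar_op) addr0.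
have dx : d_op (x_op h) = 0 by rewrite d_op_x_op dh (linear0 x_op) oppr0.
rewrite MgenE // (linear_lin_comb d_op) /= dxs dx scaler0 subr0 scalerA.
by rewrite -natrM mulnC.
Qed.

(** The coefficients in [Mgen] are crossed precisely so that this value is opposite to that of
    [d_op]. *)
Lemma dstar_op_Mgen s k h : (s <= m)%N -> Hsp s k h ->
  dstar_op (Mgen s k.+1 h) = - (Mcoef s k *: h).
Proof.
move=> sm [hh gh dh sh].
have sx : dstar_op (x_op h) = (k + (m - s))%:R *: h.
  by rewrite -(dstar_op_x_op hh gh) sh (linear0 x_op) addr0.
have sxs : dstar_op (xstar_op h) = 0.
  by rewrite dstar_op_xstar_op sh (linear0 xstar_op) oppr0.
rewrite MgenE // (linear_lin_comb dstar_op) /= sx sxs scaler0 sub0r scalerA.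
by rewrite -natrM.
Qed.

Lemma Mpart_sub_Msp s k P : (s <= m)%N -> Mpart s k.+1 P -> Msp k.+1 P.
Proof.
move=> sm [h Hh ->]; split.
  by case: Hh => hh *; exact: (homform_Mgen s hh).
rewrite -/(Mgen s k.+1 h) d_op_Mgen // dstar_op_Mgen //.
exact: subrr.
Qed.

End Monogenic.

(** * The direct sum decompositions *)

Lemma Msp_direct_sum (R : realType) (m k : nat) :
  is_direct_sum (@Msp R m.+1 k.+1)
    (fun i : 'I_m.+2 + 'I_m =>
       match i with
       | inl s => @Hsp R m.+1 s k.+1
       | inr s => @Mpart R m.+1 s.+1 k.+1
       end).
Proof.
pose c (i : 'I_m) : R[i] := @Mcoef R m.+1 i.+1 k.
have c_neq0 i : c i != 0 by apply: Mcoef_neq0; rewrite /= ltnS ltn_ord.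
have im (i : 'I_m) : (i.+1 <= m.+1)%N by rewrite ltnS ltnW.
apply: is_direct_sum_of_eq0 => [P|[s|s] P Q|u Uu].
- split=> [[hP /eqP]|[u [Uu ->]]]; last first.
    apply: Msp_sum => -[s|s]; first exact: Hsp_sub_Msp (Uu (inl s)).
    exact: Mpart_sub_Msp (im s) (Uu (inr s)).
  rewrite addr_eq0 => /eqP dP.
  have sP : dstar_op P = - d_op P by rewrite dP opprK.
  pose q (i : 'I_m) := (c i)^-1 *: deg_proj i.+1 (d_op P).
  have Hq (i : 'I_m) : Hsp i.+1 k (q i).
    (* The form [d_op P] is killed by [d_op] as one of its images, and by [dstar_op] because it also
       equals [- dstar_op P]. *)
    apply: HspZ; apply: Hsp_deg_proj; first exact: (homform_d_op hP).
      exact: d_opK.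
    by rewrite dP linearN /= dstar_opK oppr0.
  have top0 : deg_proj m.+1 (d_op P) = 0.
    by rewrite dP linearN /= deg_projm_dstar_op oppr0.
  have sum_q : \sum_i c i *: q i = d_op P.
    under eq_bigr do rewrite scalerA divff // scale1r.
    (* Of the degrees [0] to [m.+1], the bottom one is missed by [d_op] and the top one by
       [dstar_op]; the interior ones are indexed by [i.+1]. *)
    rewrite -[RHS]sum_deg_proj big_ord_recl big_ord_recr /=.
    by rewrite deg_proj0_d_op add0r [X in _ + X]top0 addr0.
  pose P' := P - \sum_(i < m) Mgen i.+1 k.+1 (q i).
  have hP' : homform k.+1 P'.
    apply: homformB => //; apply: homform_sum => i.
    by case: (Hq i) => hh *; exact: homform_Mgen.
  have dP' : d_op P' = 0.
    rewrite (linearB d_op) /= -[X in X - _]sum_q (linear_sum d_op) /=.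
    apply/eqP; rewrite subr_eq0; apply/eqP; apply: eq_bigr => i _.
    by rewrite d_op_Mgen.
  have sP' : dstar_op P' = 0.
    rewrite (linearB dstar_op) /= sP -sum_q (linear_sum dstar_op) /=.
    apply/eqP; rewrite subr_eq0 -sumrN; apply/eqP; apply: eq_bigr => i _.
    by rewrite dstar_op_Mgen.
  exists (fun i : 'I_m.+2 + 'I_m => match i with
    | inl s => deg_proj s P' | inr s => Mgen s.+1 k.+1 (q s) end); split.
    by move=> [s|s]; [exact: Hsp_deg_proj|exists (q s)].
  by rewrite big_sumType /= sum_deg_proj subrK.
- exact: HspB.
- move=> [h Hh ->] [g Hg ->]; exists (h - g); first exact: HspB.
  exact: esym (linearB (Mgen s.+1 k.+1) h g).
rewrite big_sumType /= => u0.
have [q Hq uq] := fin_all_exists2 (fun s => Uu (inr s)).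
have q0 (i : 'I_m) : q i = 0.
  have : \sum_i c i *: q i = 0.
    move: (congr1 d_op u0); rewrite linear0 linearD !linear_sum /=.
    rewrite big1 ?add0r => [du|s _]; last by have [] := Uu (inl s).
    by rewrite -[RHS]du; apply: eq_bigr => s _; rewrite uq d_op_Mgen.
  (* Each [q s] has degree [s.+1], so the projection isolates [q i], and the nonzero [c i] is
     cancelled. *)
  move=> /(congr1 (deg_proj i.+1)).
  rewrite linear_sum linear0 (bigD1 i) //= big1 ?addr0 => [|s si].
    have [_ gq _ _] := Hq i; rewrite linearZ /= (deg_proj_form _ gq) eqxx mulr1n.
    by move=> /eqP; rewrite scaler_eq0 (negbTE (c_neq0 i)) => /eqP.
  have [_ gq _ _] := Hq s; rewrite linearZ /= (deg_proj_form _ gq) eqSS eq_sym.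
  by rewrite (negbTE (si : s != i :> nat)) mulr0n scaler0.
have ur0 s : u (inr s) = 0 by rewrite uq q0; exact: linear0 (Mgen s.+1 k.+1).
case=> [s|//]; apply: (sum_deg_form_eq0 (h := fun s => u (inl s))).
  by move=> t; have [] := Uu (inl t).
by rewrite -[RHS]u0 [X in _ + X]big1 ?addr0.
Qed.

(** All derivatives of a constant form vanish, so only the splitting by exterior degree remains. The
    zero summands keep the index type of the general case and become the spaces [W^s_1]. *)
Lemma Msp0_direct_sum (R : realType) (m : nat) :
  is_direct_sum (@Msp R m.+1 0)
    (fun i : 'I_m.+2 + 'I_m =>
       match i with
       | inl s => @Hsp R m.+1 s 0
       | inr s => fun P => P = 0
       end).
Proof.
apply: is_direct_sum_of_eq0 => [P|[s|s] P Q|u Uu].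
- split=> [[hP _]|[u [Uu ->]]]; last first.
    apply: Msp_sum => -[s|s]; first exact: Hsp_sub_Msp (Uu (inl s)).
    rewrite (Uu (inr s)); split; first exact: homform0.
    by rewrite !linear0 addr0.
  exists (fun i : 'I_m.+2 + 'I_m => if i is inl s then deg_proj s P else 0); split.
    move=> [s|//]; apply: Hsp_deg_proj => //; first exact: d_op_homform0.
    exact: dstar_op_homform0.
  by rewrite big_sumType /= sum_deg_proj big1 ?addr0.
- exact: HspB.
- by move=> -> ->; rewrite subrr.
rewrite big_sumType /= [X in _ + X]big1 ?addr0 => [u0|s _]; last exact: Uu (inr s).
case=> [s|s]; last exact: Uu (inr s).
apply: (sum_deg_form_eq0 (h := fun s => u (inl s))) => //.
by move=> t; have [] := Uu (inl t).
Qed.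

(** As [x_op] and [xstar_op] square to zero, [x_plus_xstar] applied to [Mgen] leaves just the two
    mixed compositions, with unchanged coefficients. *)
Lemma image_sp_Mpart (R : realType) (m s k : nat) (Q : polyform R m) :
  image_sp x_plus_xstar (Mpart s k.+1) Q <-> Wpart s k.+2 Q.
Proof.
rewrite /Wpart /=.
have E h : x_plus_xstar (Mgen s k.+1 h) =
    (k.+2%:R - 2 + m%:R - s%:R) *: x_op (xstar_op h)
    - (k.+2%:R - 2 + s%:R) *: xstar_op (x_op h) :> polyform R m.
  have E2 : k.+2%:R - 2 = k.+1%:R - 1 :> R[i] by apply: natrS_sub2.
  have Ex : x_op (Mgen s k.+1 h) =
      (k.+1%:R - 1 + m%:R - s%:R) *: x_op (xstar_op h).
    by rewrite [LHS](linear_lin_comb x_op) /= x_opK scaler0 subr0.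
  have Exs : xstar_op (Mgen s k.+1 h) =
      - ((k.+1%:R - 1 + s%:R) *: xstar_op (x_op h)).
    by rewrite [LHS](linear_lin_comb xstar_op) /= xstar_opK scaler0 sub0r.
  by rewrite E2 -Ex -Exs.
split=> [[_ [h Hh ->] ->]|[h Hh ->]]; first by exists h; rewrite // -E.
by exists (Mgen s k.+1 h); rewrite ?E //; exists h.
Qed.

(* 'I_m.+1 indexes 0 <= s <= m; 'I_m.-1 indexes 1 <= s <= m - 1 via s.+1. *)
Theorem theorem2 (R : realType) (m : nat) (hm : (0 < m)%N)
    (k : nat) (hk : (1 <= k)%N) :
  is_direct_sum (@Msp R m k)
    (fun i : 'I_m.+1 + 'I_m.-1 =>
       match i with
       | inl s => @Hsp R m s k
       | inr s => @Mpart R m s.+1 k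
       end)
  /\
  is_direct_sum (image_sp x_plus_xstar (@Msp R m k.-1))
    (fun i : 'I_m.+1 + 'I_m.-1 =>
       match i with
       | inl s => image_sp x_plus_xstar (@Hsp R m s k.-1)
       | inr s => @Wpart R m s.+1 k
       end).
Proof.
case: m hm => // m _; case: k hk => // k _; split; first exact: Msp_direct_sum.
case: k => [|k] /=.
  apply: eq_is_direct_sum
    (is_direct_sum_image (x_plus_xstar_inj (ltn0Sn m)) (Msp0_direct_sum R m)).
  (* In order 1 [Wpart] takes its default branch, the zero space, which is the image of a zero
     summand. *)
  case=> s P //=; rewrite /Wpart /=; split=> [[_ -> ->]|->]; first exact: linear0.
  by exists 0; rewrite ?linear0.
apply: eq_is_direct_sum
  (is_direct_sum_image (x_plus_xstar_inj (ltn0Sn m)) (Msp_direct_sum R m k)).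
by case=> s P //; exact: image_sp_Mpart.
Qed.
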